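(* Let $\varepsilon>0$. For almost every character $\chi$, we have $\sum_{n=1}^N\chi(n)=O\big(N^{1/2+\varepsilon}\big)$ as $N\to+\infty$.
   Context: A character is a function $\chi:\mathbb{N}\to\mathbb{C}$ ($\mathbb{N}=\{1,2,3,\ldots\}$) with $\chi(mn)=\chi(m)\chi(n)$ and $|\chi(n)|=1$ for all $m,n$. The space $\Xi$ of characters is identified with $\mathbb{T}^\infty$ via $\chi\mapsto(\chi(2),\chi(3),\chi(5),\ldots)$ (values at the primes). ''Almost every'' refers to the probability measure $\rho$ on $\Xi$ which is the product of normalized arc length measures on $\mathbb{T}^\infty$ (the Haar measure of $\Xi$). *)

(* Defs.v *)
From HB Require Import structures.
From mathcomp Require Import all_boot all_order all_algebra.
From mathcomp Require Import complex.
From mathcomp Require Import all_classical all_reals all_analysis.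

Set Implicit Arguments.
Unset Strict Implicit.
Unset Printing Implicit Defensive.

Import Order.TTheory GRing.Theory Num.Theory.
Import numFieldNormedType.Exports.

Local Open Scope classical_set_scope.
Local Open Scope ring_scope.
Local Open Scope complex_scope.

(* Characters live on {1, 2, 3, ...}; since the carrier is nat, the junk value
   at 0 is fixed to be 0, so that a character is determined by its values at
   positive integers. *)
Record character (R : realType) := Character {
  character_fun :> nat -> R[i];
  character0 : character_fun 0%N = 0;
  characterM : forall m n : nat, (0 < m)%N -> (0 < n)%N ->
    character_fun (m * n)%N = character_fun m * character_fun n;
  character_norm : forall n : nat, (0 < n)%N -> `|character_fun n| = 1
}.

HB.instance Definition _ (R : realType) := gen_eqMixin (character R).
HB.instance Definition _ (R : realType) := gen_choiceMixin (character R).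

Section trivial_character.
Variable R : realType.

Let f (n : nat) : R[i] := (0 < n)%N%:R.

Let f0 : f 0%N = 0. Proof. by []. Qed.

Let fM (m n : nat) : (0 < m)%N -> (0 < n)%N -> f (m * n)%N = f m * f n.
Proof. by rewrite /f muln_gt0 => -> ->; rewrite mulr1. Qed.

Let f_norm (n : nat) : (0 < n)%N -> `|f n| = 1.
Proof. by rewrite /f => ->; rewrite normr1. Qed.

Definition trivial_character : character R := Character f0 fM f_norm.

End trivial_character.

HB.instance Definition _ (R : realType) :=
  isPointed.Build (character R) (trivial_character R).

(* R[i]^o is the carrier of the topology induced by the modulus. *)
Definition complex_borel (R : realType) : set (set R[i]) :=
  <<s @open R[i]^o >>.

(* [arc_prob A] is the normalized arc length of the part of A lying on the
   unit circle. *)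
Definition arc_prob (R : realType) (A : set R[i]) : \bar R :=
  (((2 * pi)^-1)%:E *
   lebesgue_measure [set t : R | (0 <= t < 2 * pi)%R /\
                                 A (cos t +i* sin t)])%E.

(* Transported along chi |-> (chi 2, chi 3, chi 5, ...), these sets generate
   the product sigma-algebra of the product of circles indexed by the primes. *)
Definition prime_cylinders (R : realType) : set (set (character R)) :=
  [set B | exists (p : nat) (A : set R[i]),
     [/\ prime p, complex_borel A & B = [set chi : character R | A (chi p)]]].

Notation character_space R := (g_sigma_algebraType (@prime_cylinders R)).

(* The product of the normalized arc lengths is the unique probability measure
   on the product sigma-algebra with these values on finite-dimensional
   rectangles. *)
Definition is_product_arc_prob (R : realType)
    (rho : probability (character_space R) R) : Prop :=
  forall (s : seq nat) (A : nat -> set R[i]),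
    uniq s -> all prime s ->
    (forall p : nat, p \in s -> complex_borel (A p)) ->
    rho [set chi : character R | forall p : nat, p \in s -> A p (chi p)] =
    (\prod_(p <- s) arc_prob (A p))%E.

(* Main.v *)
Require Import Defs.
From HB Require Import structures.
From mathcomp Require Import all_boot all_order all_algebra.
From mathcomp Require Import complex.
From mathcomp Require Import all_classical all_reals all_analysis.
From mathcomp Require Import measurable_realfun ring lra zify.
Import Order.TTheory GRing.Theory Num.Theory.
Import numFieldNormedType.Exports.
Local Open Scope classical_set_scope.
Local Open Scope ring_scope.
Local Open Scope complex_scope.

(** Under [rho] the functions [chi |-> chi n] form an orthonormal family, and
    the partial sums of an orthonormal family are almost surely
    O(N^(1/2 + eps)) by the Rademacher-Menshov dyadic maximal argument.

    Orthogonality comes from a symmetry and needs no explicit integration.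
    Rotating the value of [chi] at one prime [p] by an angle [theta] preserves
    [rho] ([rotate_character_invariant]): normalized arc length is invariant
    under rotation ([arc_prob_rotate]), and a finite measure is determined by
    its values on the rectangles, which are stable under intersection.  If
    [m != n], some prime [p] has different exponents in [m] and [n], say with
    difference [k > 0]; the rotation by [pi / k] multiplies
    [chi m * (chi n)^*] by [expi (pi / k) ^+ k = -1], so the integral of its
    real part equals its own opposite ([integral_re_dotc_character]).
    Consequently, the mean square of a sum of [k] distinct values of [chi] is
    [k] ([integral_sqr_sum_character]).

    For the maximal argument, any [N < 2 ^ K] splits the interval from 0 to
    [N] into at most [K] dyadic intervals, one per binary digit of [N], so
    [K] times the largest dyadic block bounds the partial sum
    ([norm_sum_dyadic_chaining]).  The total of the squared moduli of all the
    blocks of level below [K] has mean [K * 2 ^ K].  Divided by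
    [2 ^ K * a ^ (2 K)], with [a > 1], these means are summable over [K], so
    for almost every [chi] the totals are O(2 ^ K * a ^ (2 K))
    ([ae_dyadic_energy_bounded]).  As [K] is also O(a ^ K), the partial sums
    up to [2 ^ K] are O((sqrt 2 * a ^ 2) ^ K), and [a = 2 ^ (eps / 2)] gives
    the stated exponent. *)

Set Implicit Arguments.
Unset Strict Implicit.
Unset Printing Implicit Defensive.

(** * Borel functions on the complex plane *)

Notation borel_complex R := (g_sigma_algebraType (@open R[i]^o)).

Definition expi {R : realType} (t : R) : R[i] := cos t +i* sin t.

Lemma measurable_to_borel_complex {R : realType} d (T : measurableType d)
    (f : T -> borel_complex R) :
  (forall U : set R[i]^o, open U -> measurable (f @^-1` U)) ->
  measurable_fun setT f.
Proof.
move=> fU; apply: (@measurability d _ T (borel_complex R) setT f (@open R[i]^o)) =>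
  //.
by move=> _ [U oU <-]; rewrite setTI; exact: fU.
Qed.

Lemma normc_le_ReIm {R : realType} (z : R[i]) :
  `|z| <= (`|complex.Re z| + `|complex.Im z|)%:C.
Proof.
rewrite normc_def lecR -(@ger0_norm _ (`|_| + `|_|)) ?addr_ge0// -sqrtr_sqr.
apply: ler_wsqrtr; rewrite sqrrD !real_normK ?num_real//.
by rewrite -addrA lerD2l lerDr mulrn_wge0// mulr_ge0.
Qed.

Lemma continuous_expi (R : realType) : continuous (@expi R : R -> R[i]^o).
Proof.
move=> t; apply/(@cvgrPdist_le _ R[i]^o) => e e0.
have [r re] : exists r : R, e = r%:C.
  by apply/complex_realP; rewrite gtr0_real.
rewrite {e}re ltcR in e0 *.
have r20 : 0 < r / 2 by rewrite divr_gt0.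
have /cvgrPdist_le /(_ _ r20) C := @continuous_cos R t.
have /cvgrPdist_le /(_ _ r20) S := @continuous_sin R t.
near=> s.
apply: le_trans (normc_le_ReIm _) _; rewrite lecR /=.
by rewrite (splitr r) lerD//; near: s.
Unshelve. all: by end_near.
Qed.

Lemma measurable_expi (R : realType) :
  measurable_fun setT (@expi R : measurableTypeR R -> borel_complex R).
Proof.
apply: measurable_to_borel_complex => U oU.
apply: open_measurable.
by move/continuousP : (@continuous_expi R); exact.
Qed.

Lemma measurable_mul_complex {R : realType} (u : R[i]) :
  measurable_fun setT (fun z : borel_complex R => u * z : borel_complex R).
Proof.
apply: measurable_to_borel_complex => U oU.
apply: sub_sigma_algebra => /=.
have /continuousP : continuous (fun z : R[i]^o => u * z : R[i]^o).
  by move=> z; exact: mulrl_continuous.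
exact.
Qed.

(** The Borel sets of the line are generated by open intervals, whose preimages
    are open by continuity.  This serves for the real and imaginary parts,
    through which the products of values of characters are measurable. *)
Lemma measurable_lipschitz1_complex (R : realType) (f : R[i] -> R) :
  (forall x y, `|f x - f y|%:C <= `|x - y|) ->
  measurable_fun setT (f : borel_complex R -> measurableTypeR R).
Proof.
move=> f_lip; apply: (measurability _ (RGenOpens.measurableE R)).
move=> _ [_ [a [b ->]] <-]; rewrite setTI; apply: sub_sigma_algebra => /=.
pose g : R[i]^o -> R := f.
have /continuousP : continuous g.
  move=> x; apply/(@cvgrPdist_le _ _ R[i]^o _ (nbhs_filter (x : R[i]^o))) =>
    e e0.
  have eC : 0 < e%:C :> R[i] by rewrite ltcR.
  have xx : (y : R[i]^o) @[y --> (x : R[i]^o)] --> (x : R[i]^o)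
    by exact: cvg_id.
  near=> y; rewrite -lecR.
  have xy : `|(x : R[i]^o) - y| <= e%:C
    by near: y; move/cvgrPdist_le : xx; exact.
  exact: le_trans (f_lip _ _) xy.
by move=> /(_ _ (interval_open _ _)); exact.
Unshelve. all: by end_near.
Qed.

Lemma measurable_Re (R : realType) :
  measurable_fun setT (@complex.Re R : borel_complex R -> measurableTypeR R).
Proof.
apply: measurable_lipschitz1_complex => x y; rewrite -raddfB; exact: normc_ge_Re.
Qed.

Lemma measurable_Im (R : realType) :
  measurable_fun setT (@complex.Im R : borel_complex R -> measurableTypeR R).
Proof.
apply: measurable_lipschitz1_complex => x y.
rewrite -raddfB -normrN -ReiNIm.
apply: le_trans (normc_ge_Re _) _; rewrite normrM.
have -> : `|'i%C| = 1 :> R[i].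
  by rewrite normc_def /= expr0n /= add0r expr1n sqrtr1.
by rewrite mulr1.
Qed.

(** * Arc length and rotations of the circle *)

Lemma expiD {R : realType} (s t : R) : expi (s + t) = expi s * expi t.
Proof.
apply/eqP; rewrite eq_complex /= cosD sinD eqxx /=; apply/eqP; ring.
Qed.

Lemma expi0 {R : realType} : expi (0 : R) = 1.
Proof. by rewrite /expi cos0 sin0. Qed.

Lemma expi_pi {R : realType} : expi (pi : R) = -1.
Proof.
by rewrite /expi cospi sinpi; apply/eqP; rewrite eq_complex /= oppr0 !eqxx.
Qed.

Lemma expi2pi {R : realType} : expi (2 * pi : R) = 1.
Proof. by rewrite mulr_natl mulr2n expiD expi_pi mulrNN mulr1. Qed.

Lemma norm_expi {R : realType} (t : R) : `|expi t| = 1.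
Proof. by rewrite normc_def /= cos2Dsin2 sqrtr1. Qed.

Lemma expiMn {R : realType} (t : R) (n : nat) : expi (n%:R * t) = expi t ^+ n.
Proof.
elim: n => [|n IH]; first by rewrite mul0r expi0 expr0.
by rewrite exprS -IH -expiD -natr1; congr expi; ring.
Qed.

(** A translate of Lebesgue measure gives the same length to half-open
    intervals, and these determine it. *)
Lemma lebesgue_measure_translate {R : realType} (c : R) (A : set R) :
  measurable A -> lebesgue_measure [set t | A (t + c)] = lebesgue_measure A.
Proof.
move=> mA.
pose shift : measurableTypeR R -> measurableTypeR R := fun t => t + c.
have mshift : measurable_fun setT shift by apply: measurable_funD.
apply/esym.
apply: (lebesgue_measure_unique (mu := pushforward lebesgue_measure shift)) =>
  //= _ [[a b]] _ <-.
rewrite /pushforward /=.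
have -> : shift @^-1` `]a, b]%classic = `]a - c, b - c]%classic.
  by apply/seteqP; split => t; rewrite /shift /= !in_itv /= ltrBlDr lerBrDr.
rewrite !lebesgue_measure_itv/= !lte_fin ltrD2r -!EFinB.
by congr (if _ then _%:E else _); ring.
Qed.

(** The set of angles [t] with [A (expi t)] is invariant under translation by
    [2 * pi], so the window from [theta] to [theta + 2 * pi] has the same measure
    as the window from [0] to [2 * pi]: the part beyond [2 * pi] is a translate of
    the missing part below [theta]. *)
Lemma arc_prob_rotate {R : realType} (theta : R) (A : set R[i]) :
  0 <= theta <= 2 * pi -> complex_borel A ->
  arc_prob [set z | A (expi theta * z)] = arc_prob A.
Proof.
move=> /andP[th0 th2] mA; rewrite /arc_prob; congr (_ * _)%E.
pose E : set (measurableTypeR R) := [set t | A (expi t)].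
have mE : measurable E by rewrite -[E]setTI; exact: measurable_expi.
have Eper t : E (t + 2 * pi) = E t by rewrite /E /= expiD expi2pi mulr1.
have mI (a b : R) : measurable (E `&` [set t | a <= t < b]).
  apply: measurableI => //.
  have -> : [set t | a <= t < b] = `[a, b[%classic; last exact: measurable_itv.
  by apply/seteqP; split => t /=; rewrite in_itv.
have split3 (a b c : R) : a <= b -> b <= c ->
    lebesgue_measure (E `&` [set t | a <= t < c]) =
    (lebesgue_measure (E `&` [set t | (a <= t < b)%R]) +
     lebesgue_measure (E `&` [set t | (b <= t < c)%R]))%E.
  move=> ab bc; rewrite -measureU//; last first.
    apply/seteqP; split => // t /= [[_ /andP[_ tb]] [_ /andP[bt _]]].
    by move: (lt_le_trans tb bt); rewrite ltxx.
  congr (lebesgue_measure _); apply/seteqP; split.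
    move=> t [Et /= /andP[at_ tc]].
    by have [tb|bt] := ltP t b; [left|right]; split => //=; apply/andP.
  move=> t [] [Et /= /andP[h1 h2]]; split => //=; apply/andP; split => //.
    exact: lt_le_trans bc.
  exact: le_trans h1.
transitivity (lebesgue_measure (E `&` [set t | theta <= t < theta + 2 * pi])).
  apply/esym; rewrite -(lebesgue_measure_translate theta); last exact: mI.
  congr (lebesgue_measure _); apply/seteqP; split => t /=.
    by rewrite /E /= expiD (mulrC (expi t)) lerDr addrC ltrD2l => -[].
  by rewrite /E /= expiD (mulrC (expi t)) lerDr addrC ltrD2l => -[].
rewrite (split3 _ (2 * pi))//; last by rewrite lerDr.
transitivity (lebesgue_measure (E `&` [set t | 0 <= t < 2 * pi])); last first.
  by congr (lebesgue_measure _); apply/seteqP; split => t /= [].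
rewrite (split3 0 theta)// addeC; congr (_ + _)%E.
rewrite -(lebesgue_measure_translate (2 * pi)); last exact: mI.
congr (lebesgue_measure _); apply/seteqP; split => t /=.
  by rewrite Eper lerDr ltrD2r => -[].
by rewrite Eper lerDr ltrD2r => -[].
Qed.

(** * Rotating a random character at one prime *)

Section rotation.
Variable R : realType.
Implicit Types chi : character R.

Section rotate_character.
Variables (p : nat) (theta : R) (chi : character R).

Let f (n : nat) : R[i] := expi theta ^+ logn p n * chi n.

Let f0 : f 0 = 0. Proof. by rewrite /f character0 mulr0. Qed.

Let fM m n : (0 < m)%N -> (0 < n)%N -> f (m * n)%N = f m * f n.
Proof. by move=> m0 n0; rewrite /f lognM// characterM// exprD mulrACA. Qed.

Let f_norm n : (0 < n)%N -> `|f n| = 1.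
Proof.
by move=> n0; rewrite /f normrM normrX norm_expi expr1n mul1r character_norm.
Qed.

(** The exponent [logn p n] makes the multiplication by [expi theta] at [p]
    extend to a completely multiplicative operation on characters. *)
Definition rotate_character : character R := Character f0 fM f_norm.

End rotate_character.

Lemma rotate_characterE p theta chi n :
  rotate_character p theta chi n = expi theta ^+ logn p n * chi n.
Proof. by []. Qed.

Lemma measurable_eval_prime p : prime p ->
  measurable_fun setT (fun chi : character_space R => chi p : borel_complex R).
Proof.
move=> pp _ A mA; rewrite setTI; apply: sub_sigma_algebra.
by exists p, A.
Qed.

Lemma measurable_rotate_character p (theta : R) : prime p ->
  measurable_fun setT
    (rotate_character p theta : character_space R -> character_space R).
Proof.
move=> pp; apply: (@measurability _ _ _ (character_space R) setT _
  (@prime_cylinders R)) => // _ [B [q [A [qp mA ->]]] <-]; rewrite setTI.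
apply: sub_sigma_algebra; exists q, [set z | A (expi theta ^+ logn p q * z)].
split=> //.
have := @measurable_mul_complex R (expi theta ^+ logn p q) measurableT _ mA.
by rewrite setTI.
Qed.

(** Unlike [prime_cylinders], these sets form a pi-system, which is what the
    uniqueness theorem for measures requires. *)
Definition prime_rectangles : set (set (character_space R)) :=
  [set B | exists (s : seq nat) (A : nat -> set R[i]),
    [/\ uniq s, all prime s, forall p, complex_borel (A p) &
        B = [set chi : character R | forall p : nat, p \in s -> A p (chi p)]]].

Lemma measurable_prime_rectangles :
  prime_rectangles `<=` (@measurable _ (character_space R)).
Proof.
move=> _ [s [A [_ ps mA ->]]]; elim: s ps => [_|p s IH /= /andP[pp ps]].
  by rewrite (_ : [set _ | _] = setT)//; apply/seteqP.
rewrite (_ : [set _ | _] = [set chi : character R | A p (chi p)] `&`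
    [set chi : character R | forall q : nat, q \in s -> A q (chi q)]);
  last first.
  apply/seteqP; split => [chi h|chi [h1 h2] q]; last first.
    by rewrite inE => /predU1P[->//|]; exact: h2.
  by split => [|q qs]; apply: h; rewrite inE ?eqxx// qs orbT.
apply: measurableI; last exact: IH.
by have := @measurable_eval_prime _ pp measurableT _ (mA p); rewrite setTI.
Qed.

Lemma setI_closed_prime_rectangles : setI_closed prime_rectangles.
Proof.
move=> _ _ [s [A [us ps mA ->]]] [t [B [ut pt mB ->]]].
pose C q := (if q \in s then A q else setT) `&` (if q \in t then B q else setT).
exists (undup (s ++ t)), C; split.
- exact: undup_uniq.
- by apply/allP => q; rewrite mem_undup mem_cat => /orP[]; apply/allP.
- move=> q; apply: (@measurableI _ (borel_complex R)).
    by case: ifP => _; [exact: mA|exact: (@measurableT _ (borel_complex R))].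
  by case: ifP => _; [exact: mB|exact: (@measurableT _ (borel_complex R))].
- apply/seteqP; split => [chi [hA hB] q|chi h].
    by split; case: ifPn => // ?; [exact: hA|exact: hB].
  split => q qs; have := h q; rewrite mem_undup mem_cat qs ?orbT => /(_ isT)[];
    by rewrite qs.
Qed.

Lemma sigma_algebra_prime_rectangles :
  @measurable _ (character_space R) = <<s prime_rectangles >>.
Proof.
rewrite eqEsubset; split; apply: smallest_sub.
- exact: smallest_sigma_algebra.
- move=> _ [p [A [pp mA ->]]]; apply: sub_sigma_algebra.
  exists [:: p], (fun=> A); split => //=; first by rewrite pp.
  apply/seteqP; split => [chi h q|chi h]; last by apply: h; rewrite inE.
  by rewrite inE => /eqP ->.
- exact: sigma_algebra_measurable.
- exact: measurable_prime_rectangles.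
Qed.

Variable rho : probability (character_space R) R.
Hypothesis hrho : is_product_arc_prob rho.

(** The preimage of a rectangle is the rectangle whose side at [p] is rotated,
    and [arc_prob] does not see this rotation; both measures therefore agree on
    the pi-system of rectangles. *)
Lemma rotate_character_invariant p (theta : R) (B : set (character_space R)) :
  prime p -> 0 <= theta <= 2 * pi -> measurable B ->
  rho (rotate_character p theta @^-1` B) = rho B.
Proof.
move=> pp th mB.
have mT := @measurable_rotate_character p theta pp.
rewrite -[LHS]/(pushforward rho
  (rotate_character p theta : character_space R -> character_space R) B).
apply: (measure_unique prime_rectangles (fun=> setT)
  sigma_algebra_prime_rectangles
  setI_closed_prime_rectangles) => //.
- move=> _; exists [::], (fun=> setT); split => //.
    by move=> _; exact: (@measurableT _ (borel_complex R)).
  by apply/seteqP.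
- by rewrite bigcup_const.
- move=> _ [s [A [us ps mA ->]]].
  pose A' q := [set z | A q (expi theta ^+ logn p q * z)].
  have mA' q : complex_borel (A' q).
    have := @measurable_mul_complex R (expi theta ^+ logn p q).
    by move=> /(_ measurableT _ (mA q)); rewrite setTI.
  transitivity (\prod_(q <- s) arc_prob (A q))%E; last first.
    by apply/esym; apply: hrho.
  transitivity (\prod_(q <- s) arc_prob (A' q))%E; first exact: hrho.
  apply: eq_big_seq => q qs.
  have [->|qp] := eqVneq q p.
    rewrite -(arc_prob_rotate th (mA p)) /A'.
    by rewrite logn_prime// eqxx expr1.
  rewrite /A' logn_prime ?(allP ps)//; rewrite eq_sym (negbTE qp).
  by congr arc_prob; apply/seteqP; split => z /=; rewrite expr0 mul1r.
- by move=> k; rewrite /= /pushforward preimage_setT probability_setT ltry.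
Qed.

Lemma character1 chi : chi 1%N = 1.
Proof.
have : chi 1%N * chi 1%N = chi 1%N by rewrite -characterM.
have n0 : chi 1%N != 0 by rewrite -normr_eq0 character_norm// oner_eq0.
by move/(canRL (mulfK n0)); rewrite divff.
Qed.

(** The sigma-algebra is generated by the values at primes; the others are
    reached by splitting off the smallest prime factor. *)
Lemma measurable_ReIm_character (n : nat) :
  measurable_fun setT (fun chi : character_space R => complex.Re (chi n)) /\
  measurable_fun setT (fun chi : character_space R => complex.Im (chi n)).
Proof.
elim/ltn_ind: n => n IH.
have [n1|n1] := leqP n 1.
  have cst : exists c, forall chi : character_space R, chi n = c.
    case: n n1 {IH} => [_|[|//] _]; [exists 0|exists 1] => chi.
      exact: character0.
    exact: character1.
  have [c hc] := cst.
  by split; (under eq_fun do rewrite hc); exact: measurable_cst.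
have pn := pdiv_prime n1.
have mev := measurable_eval_prime pn.
have mR : measurable_fun setT
    (fun chi : character_space R => complex.Re (chi (pdiv n))).
  by apply: (measurableT_comp _ mev); exact: measurable_Re.
have mI : measurable_fun setT
    (fun chi : character_space R => complex.Im (chi (pdiv n))).
  by apply: (measurableT_comp _ mev); exact: measurable_Im.
have [qn q0] : (n %/ pdiv n < n)%N /\ (0 < n %/ pdiv n)%N.
  split; first by apply: ltn_Pdiv; [exact: prime_gt1|lia].
  by rewrite divn_gt0 ?pdiv_gt0// pdiv_leq//; lia.
have [mR' mI'] := IH _ qn.
have E (chi : character_space R) : chi n = chi (pdiv n) * chi (n %/ pdiv n)%N.
  by rewrite -characterM ?pdiv_gt0// mulnC divnK// pdiv_dvd.
have ReM (x y : R[i]) : complex.Re (x * y) =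
    complex.Re x * complex.Re y - complex.Im x * complex.Im y.
  by case: x y => [a b] [c d].
have ImM (x y : R[i]) : complex.Im (x * y) =
    complex.Re x * complex.Im y + complex.Im x * complex.Re y.
  by case: x y => [a b] [c d].
split; under eq_fun do rewrite E.
  under eq_fun do rewrite ReM.
  by apply: measurable_funB; apply: measurable_funM.
under eq_fun do rewrite ImM.
by apply: measurable_funD; apply: measurable_funM.
Qed.

End rotation.

(** * Orthogonality of the values of a random character *)

Section orthogonality.
Variable R : realType.
Variable rho : probability (character_space R) R.
Hypothesis hrho : is_product_arc_prob rho.
Implicit Types chi : character R.

(** The real inner product of the plane.  Working with it keeps all integrands
    real valued, and [re_dotc z z] is the squared modulus of [z]. *)
Definition re_dotc (z w : R[i]) : R := complex.Re (z * w^*).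

Lemma re_dotcE (z w : R[i]) :
  re_dotc z w = complex.Re z * complex.Re w + complex.Im z * complex.Im w.
Proof. by case: z w => [a b] [c d]; rewrite /re_dotc /= mulrN opprK. Qed.

Lemma re_dotcC (z w : R[i]) : re_dotc z w = re_dotc w z.
Proof. by rewrite !re_dotcE mulrC (mulrC (complex.Im z)). Qed.

Lemma norm_re_dotc (z w : R[i]) : `|z| = 1 -> `|w| = 1 -> `|re_dotc z w| <= 1.
Proof.
move=> z1 w1; rewrite -lecR; apply: le_trans (normc_ge_Re _) _.
by rewrite normrM normcJ z1 w1 mulr1.
Qed.

Lemma re_dotc_self (z : R[i]) : (re_dotc z z)%:C = `|z| ^+ 2.
Proof. by rewrite re_dotcE -!expr2 add_Re2_Im2. Qed.

Lemma measurable_re_dotc_character m n : measurable_fun setT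
  (fun chi : character_space R => re_dotc (chi m) (chi n)).
Proof.
have [mR mI] := measurable_ReIm_character R m.
have [nR nI] := measurable_ReIm_character R n.
under eq_fun do rewrite re_dotcE.
by apply: measurable_funD; apply: measurable_funM.
Qed.

Lemma integrable_re_dotc_character m n : (0 < m)%N -> (0 < n)%N ->
  rho.-integrable setT
    (fun chi : character_space R => (re_dotc (chi m) (chi n))%:E).
Proof.
move=> m0 n0.
apply: (@le_integrable _ _ _ rho setT measurableT _ (cst 1%E)); last first.
- exact: finite_measure_integrable_cst.
- move=> chi _ /=; rewrite lee_fin normr1.
  by apply: norm_re_dotc; exact: character_norm.

- by apply/measurable_EFinP; exact: measurable_re_dotc_character.
Qed.

Lemma exists_logn_neq m n : (0 < m)%N -> (0 < n)%N -> m != n ->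
  exists2 p, prime p & logn p m != logn p n.
Proof.
move=> m0 n0 mn; apply: contrapT => h; move/eqP: mn; apply.
apply: eqn_from_log => // p.
have [pp|np] := boolP (prime p); last by rewrite /logn (negbTE np).
by apply/eqP; apply: contrapT => /negP pmn; apply: h; exists p.
Qed.

(** With [k] the difference of the two exponents, rotating by [pi / k] at [p]
    changes the sign of the integrand and preserves the measure. *)
Lemma integral_re_dotc_lt p m n : prime p -> (0 < m)%N -> (0 < n)%N ->
  (logn p n < logn p m)%N ->
  (\int[rho]_(chi in setT) (re_dotc (chi m) (chi n))%:E = 0)%E.
Proof.
move=> pp m0 n0 nm.
pose k := (logn p m - logn p n)%N.
have k0 : (0 < k)%N by rewrite subn_gt0.
(* Chosen so that [expi theta ^+ k = expi pi = -1]. *)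
pose theta : R := pi / k%:R.
have th : 0 <= theta <= 2 * pi.
  rewrite divr_ge0 ?pi_ge0//=.
  rewrite ler_pdivrMr ?ltr0n// (@le_trans _ _ (2 * pi))//.
    by rewrite ler_peMl ?pi_ge0// ler1n.
  by rewrite ler_peMr ?ler1n// mulr_ge0// pi_ge0.
have uk : expi theta ^+ k = -1.
  by rewrite -expiMn mulrC divfK ?expi_pi// pnatr_eq0 -lt0n.
pose f (chi : character_space R) : \bar R := (re_dotc (chi m) (chi n))%:E.
pose T : character_space R -> character_space R := rotate_character p theta.
have mT : measurable_fun setT T := @measurable_rotate_character R p theta pp.
have fT chi : f (T chi) = (- f chi)%E.
  rewrite /f /re_dotc /T !rotate_characterE -EFinN; congr EFin.
  rewrite -raddfN; congr complex.Re.
  rewrite rmorphM mulrACA -(subnK (ltnW nm)) -/k exprD uk.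
  rewrite -(mulrA (-1)) [X in -1 * X * _](_ : _ = 1) ?mulr1 ?mulN1r//.
  by rewrite -[LHS]sqr_normc normrX norm_expi !expr1n.
have intf := integrable_re_dotc_character m0 n0.
have E : (\int[rho]_(chi in setT) f chi = - \int[rho]_(chi in setT) f chi)%E.
  rewrite -[RHS]integralN//; last exact: integrable_add_def.
  under [RHS]eq_integral do rewrite -fT.
  rewrite -[RHS](@integral_pushforward _ _ _ _ _ _ mT rho setT f)//;
    last 2 first.
  - by apply/measurable_EFinP; exact: measurable_re_dotc_character.
  - rewrite preimage_setT (_ : f \o T = (\- f)%E); last by apply/funext.
    exact: integrableN.
  apply: eq_measure_integral => B mB _.
  by rewrite /pushforward; apply/esym; exact: rotate_character_invariant.
have := integrable_fin_num measurableT intf; rewrite -/f.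
case: (integral _ _ _) E => // x /eqP; rewrite -EFinN eqe => /eqP xNx _.
by congr EFin; lra.
Qed.

Lemma integral_re_dotc_character m n : (0 < m)%N -> (0 < n)%N ->
  (\int[rho]_(chi in setT) (re_dotc (chi m) (chi n))%:E = (m == n)%:R%:E)%E.
Proof.
move=> m0 n0; have [<-{n n0}|mn] := eqVneq m n.
  rewrite (eq_integral (cst 1%E)) => [|chi _].
    by rewrite integral_cst// mul1e; exact: probability_setT.
  congr EFin; apply/complexI; rewrite re_dotc_self.
  by rewrite character_norm// expr1n.
have [p pp] := exists_logn_neq m0 n0 mn.
rewrite neq_ltn => /orP[lt_mn|lt_nm]; last exact: integral_re_dotc_lt lt_nm.
under eq_integral do rewrite re_dotcC.
exact: integral_re_dotc_lt lt_mn.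
Qed.

Lemma re_dotc_sum (I J : Type) (s : seq I) (t : seq J)
    (z : I -> R[i]) (w : J -> R[i]) :
  re_dotc (\sum_(i <- s) z i) (\sum_(j <- t) w j) =
  \sum_(i <- s) \sum_(j <- t) re_dotc (z i) (w j).
Proof.
rewrite /re_dotc rmorph_sum mulr_suml raddf_sum; apply: eq_bigr => i _.
by rewrite mulr_sumr raddf_sum.
Qed.

(** The shift [i.+1] keeps all the arguments positive, where characters have
    modulus 1. *)
Lemma integral_sqr_sum_character (s : seq nat) : uniq s ->
  (\int[rho]_(chi in setT)
     (re_dotc (\sum_(i <- s) chi i.+1) (\sum_(i <- s) chi i.+1))%:E
   = (size s)%:R%:E)%E.
Proof.
move=> us.
have intf (i j : nat) := integrable_re_dotc_character (ltn0Sn i) (ltn0Sn j).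
under eq_integral do rewrite re_dotc_sum -sumEFin.
under eq_integral do under eq_bigr do rewrite -sumEFin.
rewrite integral_sum//; last by move=> i; apply: integrable_sum.
under eq_bigr do rewrite integral_sum//.
under eq_bigr do under eq_bigr do rewrite integral_re_dotc_character// eqSS.
under eq_bigr do rewrite sumEFin.
rewrite sumEFin; congr EFin.
rewrite -sum1_size natr_sum; apply: eq_big_seq => i si.
rewrite (bigD1_seq i)//= eqxx big1 ?addr0// => j ji.
by rewrite eq_sym (negbTE ji).
Qed.
End orthogonality.

(** * Almost sure bounds for sums of orthonormal functions *)

(** Dropping the [j] lowest binary digits of [N] leaves the multiple
    [N %/ 2 ^ j * 2 ^ j] of [2 ^ j]; passing from [j] to [j.+1] moves this
    truncation point by one block of length [2 ^ j] if the digit is 1, and not at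
    all if it is 0.  The part of the sum above the truncation point thus grows by
    at most [M] at each of [K] steps. *)
Lemma norm_sum_dyadic_chaining (F : numDomainType) (V : normedZmodType F)
    (x : nat -> V) (K : nat) (M : F) :
  (forall j b, (j < K)%N -> (b < 2 ^ (K - j))%N ->
     `|\sum_(b * 2 ^ j <= i < b.+1 * 2 ^ j) x i| <= M) ->
  forall N, (N < 2 ^ K)%N -> `|\sum_(0 <= i < N) x i| <= M *+ K.
Proof.
move=> xM N NK.
have chain j : (j <= K)%N ->
    `|\sum_(N %/ 2 ^ j * 2 ^ j <= i < N) x i| <= M *+ j.
  elim: j => [_|j IH jK].
    by rewrite expn0 divn1 muln1 big_geq ?normr0.
  have {}IH := IH (ltnW jK).
  have := leq_trunc_div N (2 ^ j); rewrite expnSr divnMA.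
  move: IH; set q := (N %/ 2 ^ j)%N => IH qN.
  have [qo|qe] := boolP (odd q); last first.
    have -> : (q %/ 2 * (2 ^ j * 2) = q * 2 ^ j)%N.
      by rewrite [in RHS](divn_eq q 2) modn2 (negbTE qe) addn0 mulnA mulnAC.
    apply: le_trans IH _; rewrite mulrSr lerDl.
    by apply: le_trans (xM j 0%N jK _); rewrite ?expn_gt0.
  have qS : q = (q.-1).+1 by case: (q) qo.
  (* The digit of weight [2 ^ j] is 1: the block of index [q.-1] is added. *)
  have -> : (q %/ 2 * (2 ^ j * 2) = q.-1 * 2 ^ j)%N.
    suff -> : (q.-1 = q %/ 2 * 2)%N by rewrite mulnA mulnAC.
    by apply/eqP; rewrite -eqSS -qS -addn1 {1}(divn_eq q 2) modn2 qo.
  rewrite (big_cat_nat (n := q * 2 ^ j))//=; last first.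
    by rewrite leq_mul2r leq_pred orbT.
  apply: le_trans (ler_normD _ _) _; rewrite mulrS lerD//.
  rewrite {2}qS; apply: xM => //.
  rewrite -qS -(leq_pmul2r (expn_gt0 2 j)) -expnD subnK ?(ltnW jK)//.
  exact: ltnW (leq_ltn_trans qN NK).
by have := chain K (leqnn K); rewrite divn_small// mul0n.
Qed.

(** A form of Bernoulli's inequality, used to absorb into geometric growth the
    factors [K] that come from the number of dyadic levels. *)
Lemma natr_le_geometric (R : realFieldType) (a : R) (K : nat) :
  1 < a -> K%:R <= (a - 1)^-1 * a ^+ K.
Proof.
move=> a1; rewrite ler_pdivlMl ?subr_gt0//.
elim: K => [|K IH]; first by rewrite mulr0 expr0.
have aK : 1 <= a ^+ K by rewrite exprn_ege1// ltW.
by rewrite -natr1 mulrDr mulr1 exprS; nra.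
Qed.

Section almost_everywhere_bound.
Context d (T : measurableType d) (R : realType).
Variables (mu : {measure set T -> \bar R}) (X : nat -> T -> R[i]).

Let block (m n : nat) (t : T) : R[i] := \sum_(m <= i < n) X i t.

Hypothesis measurable_block : forall m n,
  measurable_fun setT (fun t => re_dotc (block m n t) (block m n t)).
Hypothesis integral_block : forall m n,
  (\int[mu]_(t in setT) (re_dotc (block m n t) (block m n t))%:E
    = (n - m)%:R%:E)%E.

Definition dyadic_energy (K : nat) (t : T) : R :=
  \sum_(j < K) \sum_(b < 2 ^ (K - j))
    re_dotc (block (b * 2 ^ j) (b.+1 * 2 ^ j) t)
            (block (b * 2 ^ j) (b.+1 * 2 ^ j) t).

Lemma re_dotc_ge0 (z : R[i]) : 0 <= re_dotc z z.
Proof. by rewrite -lecR re_dotc_self exprn_ge0. Qed.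

Lemma dyadic_energy_ge0 K t : 0 <= dyadic_energy K t.
Proof. by do 2 (apply: sumr_ge0 => ? _); exact: re_dotc_ge0. Qed.

Lemma measurable_dyadic_energy K : measurable_fun setT (dyadic_energy K).
Proof.
apply: measurable_sum => j; apply: measurable_sum => b.
exact: measurable_block.
Qed.

Lemma integral_dyadic_energy K :
  (\int[mu]_(t in setT) (dyadic_energy K t)%:E = (K%:R * 2 ^+ K)%:E)%E.
Proof.
have mb m n : measurable_fun setT
    (fun t => (re_dotc (block m n t) (block m n t))%:E).
  by apply/measurable_EFinP.
have b0 m n t : (0 <= (re_dotc (block m n t) (block m n t))%:E)%E.
  by rewrite lee_fin re_dotc_ge0.
under eq_integral do rewrite /dyadic_energy -sumEFin.
under eq_integral do under eq_bigr do rewrite -sumEFin.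
rewrite ge0_integral_sum//; last 2 first.
- by move=> j; exact: emeasurable_sum.
- by move=> j t _; exact: sume_ge0.
under eq_bigr do rewrite ge0_integral_sum//.
under eq_bigr do under eq_bigr do rewrite integral_block mulSn addnK.
under eq_bigr do rewrite sumEFin.
rewrite sumEFin; congr EFin.
rewrite (eq_bigr (fun=> 2 ^+ K)) => [|j _].
  by rewrite sumr_const card_ord mulr_natl.
rewrite sumr_const card_ord -mulrnA -expnD subnKC ?natrX//.
exact: ltnW.
Qed.

(** Each block is bounded by the square root of the sum of all squares, so the
    chaining applies. *)
Lemma norm_le_dyadic_energy K t N : (N < 2 ^ K)%N ->
  `|block 0 N t| <= (K%:R * Num.sqrt (dyadic_energy K t))%:C.
Proof.
move=> NK; rewrite mulr_natl rmorphMn/=.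
apply: norm_sum_dyadic_chaining NK => j b jK bK.
rewrite normc_def lecR; apply: ler_wsqrtr.
rewrite !expr2 -re_dotcE /dyadic_energy (bigD1 (Ordinal jK))//=.
rewrite (bigD1 (Ordinal bK))//= -addrA lerDl.
rewrite addr_ge0// sumr_ge0// => i _; rewrite ?sumr_ge0// => *;
exact: re_dotc_ge0.
Qed.


(** The integral of the series of the energies divided by [(2 * a ^+ 2) ^+ K] is
    at most the sum of the geometric series of [K |-> (a - 1)^-1 * a^-1 ^+ K].
    The series therefore converges almost everywhere, and its sum bounds each
    of its terms. *)
Lemma ae_dyadic_energy_bounded (a : R) : 1 < a ->
  {ae mu, forall t, exists C : R, 0 <= C /\
    forall K, dyadic_energy K t <= C * (2 * a ^+ 2) ^+ K}.
Proof.
move=> a1.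
have a0 : 0 < a by exact: lt_trans a1.
have a10 : 0 < a - 1 by rewrite subr_gt0.
have w0 K : 0 < (2 * a ^+ 2) ^+ K by rewrite exprn_gt0// mulr_gt0// exprn_gt0.
pose f (K : nat) (t : T) : \bar R :=
  (dyadic_energy K t / (2 * a ^+ 2) ^+ K)%:E.
have f0 K t : (0 <= f K t)%E.
  by rewrite lee_fin divr_ge0 ?dyadic_energy_ge0// ltW.
have mf K : measurable_fun setT (f K).
  apply/measurable_EFinP; apply: measurable_funM => //.
  exact: measurable_dyadic_energy.
have intf K : (\int[mu]_(t in setT) f K t <= ((a - 1)^-1 * a^-1 ^+ K)%:E)%E.
  rewrite /f; under eq_integral do rewrite EFinM muleC.
  rewrite ge0_integralZl//; last 3 first.
  - by apply/measurable_EFinP; exact: measurable_dyadic_energy.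
  - by move=> t _; rewrite lee_fin dyadic_energy_ge0.
  - by rewrite lee_fin invr_ge0 ltW.
  rewrite integral_dyadic_energy -EFinM lee_fin mulrC ler_pdivrMr//.
  have -> : (2 * a ^+ 2) ^+ K = 2 ^+ K * a ^+ K * a ^+ K.
    by rewrite exprMn -exprM mul2n -addnn exprD mulrA.
  rewrite [leRHS](_ : _ = (a - 1)^-1 * a ^+ K * 2 ^+ K).
    by rewrite ler_pM2r ?exprn_gt0//; exact: natr_le_geometric.
  by rewrite exprVn; field; rewrite expf_neq0 ?gt_eqF.
have fin : (\int[mu]_(t in setT) (\sum_(K <oo) f K t) < +oo)%E.
  rewrite integral_nneseries//.
  apply: (@le_lt_trans _ _ ((a - 1)^-1 * (1 - a^-1)^-1)%:E); last exact: ltry.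
  apply: lime_le.
    by apply: is_cvg_nneseries => K _ _; exact: integral_ge0.
  near=> n.
  apply: (@le_trans _ _ (\sum_(0 <= K < n) ((a - 1)^-1 * a^-1 ^+ K)%:E)%E).
    by apply: lee_sum => K _; exact: intf.
  rewrite sumEFin lee_fin -mulr_sumr ler_pM2l ?invr_gt0//.
  have q1 : 0 < 1 - a^-1 by rewrite subr_gt0 invf_lt1.
  rewrite -[X in _ <= X]mul1r ler_pdivlMr// mulrC big_mkord.
  rewrite -opprB mulNr -subrX1 opprB.
  by rewrite lerBlDr lerDl exprn_ge0// invr_ge0 ltW.
have intF : mu.-integrable setT (fun t => \sum_(K <oo) f K t)%E.
  apply/integrableP; split; first exact: ge0_emeasurable_sum.
  by under eq_integral do rewrite gee0_abs ?nneseries_ge0//.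
have := integrable_ae measurableT intF.
apply: filterS => t /(_ I) Ft.
exists (fine (\sum_(K <oo) f K t)%E); split.
  by rewrite fine_ge0// nneseries_ge0.
move=> K; rewrite -ler_pdivrMr// -lee_fin fineK//.
apply: le_trans (nneseries_lim_ge K.+1 _) => //.
by rewrite big_nat_recr//= leeDr// sume_ge0.
Unshelve. all: by end_near.
Qed.

(** With [2 ^ k <= N < 2 ^ k.+1], the chaining costs a factor [k.+1], which is
    O(a ^ k.+1), and the energy is O((2 * a ^+ 2) ^+ k.+1).  The choice of [a] makes
    [2 * a ^+ 4] the square of [g], whose powers [g ^+ k] are at most
    [N `^ (2^-1 + eps)]. *)
Lemma ae_partial_sum_bound (eps : R) : 0 < eps ->
  {ae mu, forall t, exists C : R, forall N, (0 < N)%N ->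
    `|block 0 N t| <= (C * N%:R `^ (2^-1 + eps))%:C}.
Proof.
move=> eps0.
pose a : R := 2 `^ (eps / 2).
pose g : R := 2 `^ (2^-1 + eps).
have a1 : 1 < a.
  have one : 1 `^ (eps / 2) = 1 :> R by rewrite powR1.
  by rewrite /a -{1}one gt0_ltr_powR ?divr_gt0// ?nnegrE// ltr1n.
have a0 : 0 < a by exact: lt_trans a1.
have a10 : 0 < a - 1 by rewrite subr_gt0.
have g2 : g ^+ 2 = 2 * a ^+ 4.
  rewrite -!powR_mulrn ?powR_ge0// /g /a -!powRrM.
  have two : 2 = 2 `^ 1 :> R by rewrite powRr1.
  rewrite [X in _ = X * _]two.
  by rewrite -powRD ?pnatr_eq0 ?implybT//; congr powR; field.
have g0 : 0 < g by rewrite powR_gt0.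
have := ae_dyadic_energy_bounded a1; apply: filterS => t [C [C0 energyC]].
exists ((a - 1)^-1 * Num.sqrt C * g) => N N0.
have [NK KN] : (N < 2 ^ (trunc_log 2 N).+1)%N /\ (2 ^ trunc_log 2 N <= N)%N.
  by rewrite trunc_log_ltn// trunc_logP.
move: (trunc_log 2 N) NK KN => k NK KN.
apply: le_trans (norm_le_dyadic_energy t NK) _; rewrite lecR.
have energy_k : Num.sqrt (dyadic_energy k.+1 t) <= Num.sqrt C * (g / a) ^+ k.+1.
  have ga0 : 0 <= (g / a) ^+ k.+1 by rewrite exprn_ge0// divr_ge0// ltW.
  rewrite -[X in _ * X]ger0_norm// -sqrtr_sqr -sqrtrM//.
  apply: ler_wsqrtr; apply: le_trans (energyC _) _.
  rewrite -exprM mulnC exprM expr_div_n g2.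
  have -> : 2 * a ^+ 4 / a ^+ 2 = 2 * a ^+ 2 by field; rewrite gt_eqF.
  by [].
have k_le : k.+1%:R <= (a - 1)^-1 * a ^+ k.+1.
  exact: natr_le_geometric.
have gk : g ^+ k <= N%:R `^ (2^-1 + eps).
  rewrite -powR_mulrn ?powR_ge0// /g powRAC powR_mulrn// -natrX.
  by rewrite ge0_ler_powR ?nnegrE// ?ler_nat// addr_ge0// ?invr_ge0// ltW.
apply: le_trans (ler_pM _ _ k_le energy_k) _; rewrite ?sqrtr_ge0//.
rewrite [X in X <= _](_ : _ = (a - 1)^-1 * Num.sqrt C * g * g ^+ k).
  rewrite ler_wpM2l// mulr_ge0 ?(ltW g0)// mulr_ge0 ?sqrtr_ge0//.
  by rewrite invr_ge0 ltW.
rewrite mulrACA -exprMn (mulrC a) divfK ?gt_eqF// exprS mulrA //.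
Qed.

End almost_everywhere_bound.

(** * Partial sums of a random character *)

Unset Implicit Arguments.
Theorem corollary4p8 (R : realType)
  (rho : probability (character_space R) R)
  (hrho : is_product_arc_prob rho)
  (eps : R) (heps : 0 < eps) :
  {ae rho, forall chi : character R,
    ((fun N : nat => \sum_(1 <= n < N.+1) chi n) : nat -> R[i]^o)
      =O_\oo (fun N : nat => (N%:R `^ (2^-1 + eps))%:C : R[i]^o)}.
Proof.
pose X (i : nat) (chi : character_space R) : R[i] := chi i.+1.
have mX m n : measurable_fun setT (fun chi =>
    re_dotc (\sum_(m <= i < n) X i chi) (\sum_(m <= i < n) X i chi)).
  under eq_fun do rewrite re_dotc_sum.
  apply: measurable_sum => i; apply: measurable_sum => j.
  exact: measurable_re_dotc_character.
have iX m n : (\int[rho]_(chi in setT)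
    (re_dotc (\sum_(m <= i < n) X i chi) (\sum_(m <= i < n) X i chi))%:E
    = (n - m)%:R%:E)%E.
  rewrite -[in RHS](size_iota m (n - m)).
  by rewrite -(integral_sqr_sum_character hrho) ?iota_uniq.
have := ae_partial_sum_bound mX iX heps; apply: filterS => chi [C boundC].
apply/eqO_exP; exists (Num.max C 1)%:C.
  by rewrite ltcR lt_max ltr01 orbT.
near=> N.
have N0 : (0 < N)%N by near: N; exact: nbhs_infty_gt.
rewrite big_add1/=; apply: le_trans (boundC N N0) _.
rewrite ger0_norm ?lecR ?powR_ge0// -rmorphM lecR.
by rewrite ler_wpM2r ?powR_ge0// le_max lexx.
Unshelve. all: by end_near.
Qed.
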